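(* Let $(\beta,\mathcal{A})$ be a numeration system such that $\beta$ is an algebraic number and $\mathcal{A}[\beta]=\mathbb{Z}[\beta]$. If $(\beta,\mathcal{A})$ allows parallel addition, then the alphabet $\mathcal{A}$ contains at least one representative of each congruence class modulo $\beta$ in $\mathbb{Z}[\beta]$ and at least one representative of each congruence class modulo $\beta-1$ in $\mathbb{Z}[\beta]$.
   Context: $\mathbb{N}$ contains $0$. $\mathbb{Z}[\beta]$ is the smallest ring containing $\mathbb{Z}$ and $\beta$. For $\alpha,\gamma,\delta\in\mathbb{Z}[\beta]$, $\gamma$ is congruent to $\delta$ modulo $\alpha$ in $\mathbb{Z}[\beta]$ if there exists $\varepsilon\in\mathbb{Z}[\beta]$ with $\gamma-\delta=\alpha\varepsilon$. A numeration system is a pair $(\beta,\mathcal{A})$ where $\beta\in\mathbb{C}$, $|\beta|>1$ (the base), and $\mathcal{A}\subset\mathbb{C}$ is a finite set containing $0$ (the alphabet). Define $\mathcal{A}[\beta]=\{\sum_{j=0}^n x_j\beta^j : n\in\mathbb{N},\ x_j\in\mathcal{A}\}$. For alphabets $\mathcal{A},\mathcal{B}$, a function $\varphi:\mathcal{B}^{\mathbb{Z}}\to\mathcal{A}^{\mathbb{Z}}$ is $p$-local if there exist $r,t\in\mathbb{N}$ with $p=r+t+1$ and a function $\phi:\mathcal{B}^p\to\mathcal{A}$ such that for every $w=(w_j)_{j\in\mathbb{Z}}\in\mathcal{B}^{\mathbb{Z}}$ its image $z=\varphi(w)=(z_j)_{j\in\mathbb{Z}}$ satisfies $z_j=\phi(w_{j+t},\dots,w_{j-r})$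 for all $j\in\mathbb{Z}$. A digit set conversion in base $\beta$ from $\mathcal{B}$ to $\mathcal{A}$ (alphabets containing $0$) is a function $\varphi:\mathcal{B}^{\mathbb{Z}}\to\mathcal{A}^{\mathbb{Z}}$ such that for every $w=(w_j)_{j\in\mathbb{Z}}\in\mathcal{B}^{\mathbb{Z}}$ with finitely many non-zero digits, $z=\varphi(w)$ has only finitely many non-zero digits and $\sum_{j\in\mathbb{Z}}w_j\beta^j=\sum_{j\in\mathbb{Z}}z_j\beta^j$. Parallel addition in $(\beta,\mathcal{A})$ is a digit set conversion in base $\beta$ from $\mathcal{A}+\mathcal{A}=\{a+a' : a,a'\in\mathcal{A}\}$ to $\mathcal{A}$ that is $p$-local for some $p\in\mathbb{N}$; $(\beta,\mathcal{A})$ allows parallel addition if such a function exists. *)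

(* Defs.v *)
From HB Require Import structures.
From mathcomp Require Import all_boot all_order all_algebra.
From mathcomp Require Import finmap complex.
From mathcomp Require Import mathcomp_extra boolp classical_sets functions cardinality fsbigop reals.

Set Implicit Arguments.
Unset Strict Implicit.
Unset Printing Implicit Defensive.

Import Order.TTheory GRing.Theory Num.Theory.
Local Open Scope ring_scope.
Local Open Scope complex_scope.
Local Open Scope fset_scope.

(* The field of complex numbers is R[i], for R : realType. *)

Definition algebraic_number (R : realType) (x : R[i]) : Prop :=
  algebraicOver (ratr : rat -> R[i]) x.

Definition Zadjoin (R : realType) (beta : R[i]) : set R[i] :=
  smallest (fun S : set R[i] => subring_closed [in S])
    (range (fun n : int => n%:~R : R[i]) `|` [set beta])%classic.

Definition congruent_mod (R : realType) (beta alpha gamma delta : R[i]) : Prop :=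
  exists2 epsilon, Zadjoin beta epsilon & gamma - delta = alpha * epsilon.

(* Norms in R[i] are elements of R[i] with zero imaginary part, on which the
   order of R[i] is that of R. *)
Definition numeration_system (R : realType) (beta : R[i]) (A : {fset R[i]}) : Prop :=
  1 < `|beta| /\ 0 \in A.

Definition digit_polys (R : realType) (beta : R[i]) (A : {fset R[i]}) : set R[i] :=
  [set y | exists (n : nat) (x : 'I_n.+1 -> A),
             y = \sum_(j < n.+1) val (x j) * beta ^+ j]%classic.

Definition is_local (R : realType) (A B : {fset R[i]}) (p : nat)
    (phi : (int -> B) -> (int -> A)) : Prop :=
  exists (r t : nat) (f : p.-tuple B -> A),
    p = (r + t + 1)%N /\
    forall (w : int -> B) (j : int),
      phi w j = f [tuple w (j + t%:Z - (i : nat)%:Z) | i < p].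

Definition finitely_nonzero (R : realType) (A : {fset R[i]}) (w : int -> A) : Prop :=
  finite_set [set j | val (w j) <> 0]%classic.

(* A sum over all of Z, meaningful when w is finitely nonzero: \sum_(j \in _)
   is the sum of the nonzero terms if there are finitely many, and 0 if not. *)
Definition word_value (R : realType) (beta : R[i]) (A : {fset R[i]})
    (w : int -> A) : R[i] :=
  \sum_(j \in [set: int]%classic) val (w j) * beta ^ j.

Definition digit_set_conversion (R : realType) (beta : R[i]) (B A : {fset R[i]})
    (phi : (int -> B) -> (int -> A)) : Prop :=
  forall w : int -> B, finitely_nonzero w ->
    finitely_nonzero (phi w) /\ word_value beta w = word_value beta (phi w).

Definition fset_sum (R : realType) (A B : {fset R[i]}) : {fset R[i]} :=
  [fset (a + b)%R | a in A, b in B].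

Definition allows_parallel_addition (R : realType) (beta : R[i])
    (A : {fset R[i]}) : Prop :=
  exists (phi : (int -> fset_sum A A) -> (int -> A)) (p : nat),
    digit_set_conversion beta phi /\ is_local p phi.

Definition has_all_representatives (R : realType) (beta alpha : R[i])
    (A : {fset R[i]}) : Prop :=
  forall gamma, Zadjoin beta gamma ->
    exists2 a, a \in A & congruent_mod beta alpha a gamma.

(* Main.v *)
Require Import Defs.
From HB Require Import structures.
From mathcomp Require Import all_boot all_order all_algebra.
From mathcomp Require Import finmap complex zify ring.
From mathcomp Require Import boolp classical_sets functions cardinality fsbigop reals.

Import Order.TTheory GRing.Theory Num.Theory.
Local Open Scope ring_scope.
Local Open Scope complex_scope.

(** Every element of Z[beta] is a value x_0 + x_1 beta + ... + x_n beta^n with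
    digits in the alphabet, and the two residues are read off this expansion.

    Modulo beta it is congruent to its constant digit x_0.

    Modulo beta - 1 every power of beta is 1, so it is congruent to the sum of
    its digits, and it remains to see that a sum of digits is congruent to a
    digit. Adding the digits one at a time, this reduces to sums of two digits:
    every x in A + A is congruent to some a in A. That is where parallel
    addition enters ([local_conversion_congr]). A conversion preserves values,
    hence preserves digit sums modulo beta - 1
    ([word_value_congr_digit_sum]). Take a block w of consecutive x's, as long
    as the window of the conversion, and the block w' with one more x. A
    local conversion cannot see this change except by repeating, in the middle
    of the image, the letter a that it produces when its window contains only
    x's: the image of w' is the image of w with that a duplicated
    ([digit_sum_repeat]). The digit sum grows by x on the input side and by a
    on the output side, so x and a are congruent. *)

Lemma Zadjoin_subring_closed {R : realType} (beta : R[i]) :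
  GRing.subring_closed [in Zadjoin beta].
Proof.
split=> [|x y|x y]; rewrite !inE.
- by move=> S [[]]; rewrite !inE.
- move=> Zx Zy S HS; have [] := HS.1 => _ + _ => /(_ x y).
  by rewrite !inE; apply; [apply: Zx | apply: Zy].
- move=> Zx Zy S HS; have [] := HS.1 => _ _ /(_ x y).
  by rewrite !inE; apply; [apply: Zx | apply: Zy].
Qed.

(** A named predicate is needed to attach the subring structure to Z[beta], which
    makes the generic closure lemmas available. *)
Definition Zbeta {R : realType} (beta : R[i]) : {pred R[i]} :=
  [in Zadjoin beta].

HB.instance Definition _ (R : realType) (beta : R[i]) :=
  GRing.isSubringClosed.Build R[i] (Zbeta beta) (Zadjoin_subring_closed beta).

Lemma ZbetaP {R : realType} {beta x : R[i]} :
  reflect (Zadjoin beta x) (x \in Zbeta beta).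
Proof. exact: asboolP. Qed.

Lemma base_Zbeta {R : realType} (beta : R[i]) : beta \in Zbeta beta.
Proof. by apply/ZbetaP => S [_]; apply; right. Qed.

Section Congruence.
Context {R : realType} {beta alpha : R[i]}.
Local Notation "x ≡ y" := (congruent_mod beta alpha x y) (at level 70).

Lemma congr_refl x : x ≡ x.
Proof. by exists 0; rewrite ?subrr ?mulr0 //; apply/ZbetaP/rpred0. Qed.

Lemma congr_sym {x y} : x ≡ y -> y ≡ x.
Proof.
case=> e /ZbetaP Ze xy; exists (- e); first by apply/ZbetaP; rewrite rpredN.
by rewrite mulrN -xy opprB.
Qed.

Lemma congr_trans {x y z} : x ≡ y -> y ≡ z -> x ≡ z.
Proof.
case=> e /ZbetaP Ze xy [f /ZbetaP Zf yz].
exists (e + f); first by apply/ZbetaP; rewrite rpredD.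
by rewrite mulrDr -xy -yz; ring.
Qed.

Lemma congrD {x y x' y'} : x ≡ y -> x' ≡ y' -> x + x' ≡ y + y'.
Proof.
case=> e /ZbetaP Ze xy [f /ZbetaP Zf xy'].
exists (e + f); first by apply/ZbetaP; rewrite rpredD.
by rewrite mulrDr -xy -xy'; ring.
Qed.

Lemma congrMl {c x y} : c \in Zbeta beta -> x ≡ y -> c * x ≡ c * y.
Proof.
move=> Zc [e /ZbetaP Ze xy].
exists (c * e); first by apply/ZbetaP; rewrite rpredM.
by rewrite -mulrBr xy mulrCA.
Qed.

Lemma congrB {x y x' y'} : x ≡ y -> x' ≡ y' -> x - x' ≡ y - y'.
Proof.
move=> xy xy'; apply: congrD xy _; rewrite -mulN1r -[- y']mulN1r.
by apply: congrMl xy'; rewrite rpredN1.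
Qed.

Lemma congr_sum n {F G : 'I_n -> R[i]} :
  (forall i, F i ≡ G i) -> \sum_i F i ≡ \sum_i G i.
Proof.
by move=> FG; elim/big_ind2: _ => // *; [apply: congr_refl | apply: congrD].
Qed.

End Congruence.

Lemma exp_base_congr1 {R : realType} (beta : R[i]) n :
  congruent_mod beta (beta - 1) (beta ^+ n) 1.
Proof.
exists (\sum_(i < n) beta ^+ i); last by rewrite -subrX1.
by apply/ZbetaP; rewrite rpred_sum // => i _; rewrite rpredX ?base_Zbeta.
Qed.

(** Evaluation at beta and evaluation at 1 agree modulo beta - 1. *)
Lemma poly_base_congr_sum {R : realType} {beta : R[i]} n (c : 'I_n -> R[i]) :
  (forall i, c i \in Zbeta beta) ->
  congruent_mod beta (beta - 1) (\sum_i c i * beta ^+ i) (\sum_i c i).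
Proof.
move=> Zc; apply: congr_sum => i; rewrite -[X in congruent_mod _ _ _ X]mulr1.
by apply: congrMl (Zc i) _; apply: exp_base_congr1.
Qed.

(** Words live on all of Z, while the digit sums are over ordinals: the n
    positions are counted from - s, so that digit i of the sum is the digit of
    the word at position i - s. *)
Definition supported_in {R : realType} {A : {fset R[i]}} (s n : nat)
    (w : int -> A) :=
  forall j : int, ~~ (- s%:Z <= j < n%:Z - s%:Z) -> val (w j) = 0.

Lemma finitely_nonzero_supported {R : realType} {A : {fset R[i]}} {s n}
  {w : int -> A} : supported_in s n w -> finitely_nonzero w.
Proof.
move=> sw; apply: (sub_finite_set _ (finite_seq [seq k%:Z - s%:Z | k <- iota 0 n])).
move=> j /= wj; have js : - s%:Z <= j < n%:Z - s%:Z by apply: contra_notT wj; apply: sw.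
by apply/mapP; exists `|(j + s%:Z)%R|%N; rewrite ?mem_iota; lia.
Qed.

Lemma word_value_supported {R : realType} (beta : R[i]) {A : {fset R[i]}} {s n}
    {w : int -> A} :
  supported_in s n w ->
  word_value beta w = \sum_(i < n) val (w (i%:Z - s%:Z)) * beta ^ (i%:Z - s%:Z).
Proof.
move=> sw; pose r : seq int := [seq k%:Z - s%:Z | k <- iota 0 n].
rewrite /word_value (fsbigE r) //=.
- rewrite big_map (eq_bigl xpredT) => [|j]; last exact: in_setT.
  by rewrite -[n in iota 0 n]subn0 -/(index_iota 0 n) big_mkord.
- by rewrite map_inj_uniq ?iota_uniq // => a b; lia.
- move=> j _ jr; rewrite sw ?mul0r //; apply: contra jr => js.
  by apply/mapP; exists `|(j + s%:Z)%R|%N; rewrite ?mem_iota; lia.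
Qed.

(** The factor beta ^+ s clears the negative powers of beta, which need not lie
    in Z[beta]; it does no harm, being itself congruent to 1. *)
Lemma word_value_congr_digit_sum {R : realType} {beta : R[i]} {A : {fset R[i]}}
    {s n} {w : int -> A} :
  beta != 0 -> {in A, forall a, a \in Zbeta beta} -> supported_in s n w ->
  congruent_mod beta (beta - 1) (beta ^+ s * word_value beta w)
    (\sum_(i < n) val (w (i%:Z - s%:Z))).
Proof.
move=> beta0 ZA sw; rewrite (word_value_supported beta sw) mulr_sumr.
rewrite (eq_bigr (fun i : 'I_n => val (w (i%:Z - s%:Z)) * beta ^+ i)).
  by apply: poly_base_congr_sum => i; apply/ZA/valP.
move=> i _; rewrite mulrCA; congr (_ * _).
by rewrite !exprnP -expfzDr //; congr (_ ^ _); lia.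
Qed.

(** Here v is u with its entry at k written twice: both hypotheses apply to the
    index k, which makes k and k.+1 the two copies. *)
Lemma digit_sum_repeat {V : zmodType} {n} (k : 'I_n.+1) (u v : nat -> V) :
  (forall i, (i <= k)%N -> v i = u i) ->
  (forall i, (k <= i)%N -> v i.+1 = u i) ->
  \sum_(i < n.+1) v i - \sum_(i < n) u i = u k.
Proof.
move=> vlo vhi; rewrite (bigD1_ord k) //= vlo //.
rewrite (eq_bigr (fun i : 'I_n => u i)) ?addrK // => i _.
by rewrite /= /bump; case: leqP => [/vhi | /ltnW/vlo].
Qed.

(** A symmetric window of radius q is all that is used of locality: it covers
    both the translation invariance (j and j' may differ) and the bounded
    dependence of the output letter. *)
Lemma is_local_window {R : realType} {A B : {fset R[i]}} {p}
    {phi : (int -> B) -> (int -> A)} :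
  is_local p phi ->
  exists q : nat, forall (w w' : int -> B) (j j' : int),
    (forall k : int, - q%:Z <= k <= q%:Z -> w (j + k) = w' (j' + k)) ->
    phi w j = phi w' j'.
Proof.
case=> r [t [f [pE phiE]]]; exists (r + t)%N => w w' j j' ww'.
rewrite !phiE; congr f; apply: eq_from_tnth => i; rewrite !tnth_mktuple.
by rewrite -!addrA; apply: ww'; have := ltn_ord i; lia.
Qed.

(** The effect of a conversion on a constant bi-infinite word x x x ..., whose
    value makes no sense, is seen through the finite blocks [w 0] and [w 1]. *)
Lemma local_conversion_congr {R : realType} {beta : R[i]} {A B : {fset R[i]}} {p}
    {phi : (int -> B) -> (int -> A)} :
  beta != 0 -> 0 \in B ->
  {in A, forall a, a \in Zbeta beta} ->
  {in B, forall b, b \in Zbeta beta} ->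
  digit_set_conversion beta phi -> is_local p phi ->
  forall x, x \in B -> exists2 a, a \in A & congruent_mod beta (beta - 1) a x.
Proof.
move=> beta0 B0 ZA ZB conv /is_local_window [q loc] x Bx.
pose o : B := [` B0]%fset; pose X : B := [` Bx]%fset.
(* The window at position 0 sees exactly the block of w 0. The right end of the
   block of w 1 is one further, so w 1 is w 0 with the letter at 0 doubled; the
   images live on the block widened by q on both sides. *)
pose w (m : nat) (j : int) := if - q%:Z <= j <= q%:Z + m%:Z then X else o.
pose s := (q + q)%N; pose N m := (m + (s + s)).+1.
have sw m : supported_in s (N m) (w m).
  by move=> j; rewrite /w /N /s => js; case: ifP => // jq; exfalso; lia.
(* A local conversion fixes the zero word: its image is constant by locality, and
   finitely nonzero. *)
have phi0 j : val (phi (fun=> o) j) = 0.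
  have so : supported_in 0 0 (fun=> o) by [].
  have [fin _] := conv _ (finitely_nonzero_supported so).
  apply: contrapT => nz; apply: infinite_nat.
  apply: (sub_finite_set _ (finite_preimage (f := Posz) _ fin)) => [i _ /=|a b _ _ []//].
  by rewrite (loc _ (fun=> o) _ j).
have sz m : supported_in s (N m) (phi (w m)).
  move=> j; rewrite /N /s => js; rewrite -(phi0 j); congr val.
  by apply: loc => i iq; rewrite /w; case: ifP => // ijq; exfalso; lia.
have val_w m : word_value beta (phi (w m)) = word_value beta (w m).
  by have [_ ->] := conv _ (finitely_nonzero_supported (sw m)).
have sN : (s < (N 0).+1)%N by rewrite /N; lia.
pose k := Ordinal sN.
have s0 : k%:Z - s%:Z = 0 by rewrite subrr.
have DX : \sum_(i < N 1) val (w 1 (i%:Z - s%:Z))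
   - \sum_(i < N 0) val (w 0 (i%:Z - s%:Z)) = x.
  rewrite (digit_sum_repeat k (fun i : nat => val (w 0 (i%:Z - s%:Z)))
    (fun i : nat => val (w 1 (i%:Z - s%:Z)))) /w.
  - by rewrite s0; case: ifP => // q0; exfalso; lia.
  - by move=> i /=; rewrite /s => ik; congr val; do 2 case: ifP => //; lia.
  - by move=> i /=; rewrite /s => ik; congr val; do 2 case: ifP => //; lia.
pose a := phi (w 0) 0; exists (val a); first exact: valP.
(* At positions up to 0 the window does not pass the right end q of the block of
   w 0, before which both words agree; at later positions of the second image,
   shifted back by one, it does not pass the common left end - q, after which
   the words agree up to this shift. *)
have Da : \sum_(i < N 1) val (phi (w 1) (i%:Z - s%:Z))
   - \sum_(i < N 0) val (phi (w 0) (i%:Z - s%:Z)) = val a.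
  rewrite (digit_sum_repeat k (fun i : nat => val (phi (w 0) (i%:Z - s%:Z)))
    (fun i : nat => val (phi (w 1) (i%:Z - s%:Z)))) ?s0 // => i /=; rewrite /s => ik;
    congr val; apply: loc => l lq; rewrite /w; do 2 case: ifP => //; lia.
rewrite -DX -Da.
apply: (congr_trans (y := beta ^+ s * word_value beta (w 1)
   - beta ^+ s * word_value beta (w 0))).
  by apply: congr_sym; rewrite -!val_w; apply: congrB; apply: word_value_congr_digit_sum.
by apply: congrB; apply: word_value_congr_digit_sum.
Qed.

Theorem theorem3p7 (R : realType) (beta : R[i]) (A : {fset R[i]}) :
  numeration_system beta A ->
  algebraic_number beta ->
  digit_polys beta A = Zadjoin beta ->
  allows_parallel_addition beta A ->
  has_all_representatives beta beta A /\
  has_all_representatives beta (beta - 1) A.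
Proof.
move=> [beta_gt1 A0] _ AZ [phi [p [conv loc]]].
have beta0 : beta != 0.
  by apply: contraTneq beta_gt1 => ->; rewrite normr0 ltr10.
have ZA : {in A, forall a, a \in Zbeta beta}.
  move=> a Aa; apply/ZbetaP; rewrite -AZ; exists 0%N, (fun=> [` Aa]%fset).
  by rewrite big_ord1 expr0 mulr1.
split=> gamma; rewrite -AZ => -[n [x ->]].
  exists (val (x ord0)); first exact: valP.
  apply: congr_sym; rewrite big_ord_recl expr0 mulr1.
  exists (\sum_(i < n) val (x (lift ord0 i)) * beta ^+ i).
    apply/ZbetaP; rewrite rpred_sum // => i _.
    by rewrite rpredM ?rpredX ?base_Zbeta //; apply/ZA/valP.
  rewrite addrC addKr mulr_sumr; apply: eq_bigr => i _.
  by rewrite mulrCA -exprS.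
have B_digit c : c \in fset_sum A A -> exists2 a, a \in A &
    congruent_mod beta (beta - 1) a c.
  apply: (local_conversion_congr _ _ _ _ conv loc) => //.
    by apply/imfset2P; exists 0 => //; exists 0; rewrite ?addr0.
  by move=> c' /imfset2P [a Aa [b Ab ->]]; rewrite rpredD ?ZA.
(* A partial sum is represented by some a in A; adding the next digit gives an
   element of A + A, which is brought back to A. *)
have [a Aa ax] : exists2 a, a \in A &
    congruent_mod beta (beta - 1) a (\sum_j val (x j)).
  elim/big_rec: _ => [|j s _ [a Aa as_]]; first by exists 0 => //; apply: congr_refl.
  have [|b Ab bs] := B_digit (val (x j) + a).
    by apply/imfset2P; exists (val (x j)); [apply: valP | exists a].
  by exists b => //; apply: congr_trans bs (congrD (congr_refl _) as_).
exists a => //; apply: congr_trans ax (congr_sym _).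
by apply: poly_base_congr_sum => j; apply/ZA/valP.
Qed.
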